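(* Let $(x(t))_{t\ge 0}$ be a trajectory of the mixed Hegselmann-Krause model with $n$ agents, opinions in $\mathbf{R}^d$, confidence bound $\epsilon>0$ and stubbornness degrees $\alpha_i(t)\in[0,1]$. For $t\in\mathbf{N}$ let $$\beta_t=\max_{i,j\in[n],\ \alpha_i(t)\ge\alpha_j(t)}\left(\alpha_i(t)-\frac{\alpha_i(t)-\alpha_j(t)}{n}\right).$$ Assume that $\limsup_{t\to\infty}\beta_t<1$ and that the profile $\mathscr{G}(t_0)$ is $\epsilon$-trivial for some time $t_0\in\mathbf{N}$. Then $$\lim_{t\to\infty}\ \max_{i,j\in[n]}\|x_i(t)-x_j(t)\|=0.$$
   Context: Notation: $[n]=\{1,\dots,n\}$ with $n\ge 1$, $\mathbf{N}=\{0,1,2,\dots\}$, $\|\cdot\|$ is the Euclidean norm on $\mathbf{R}^d$. Mixed Hegselmann-Krause model: given $\epsilon>0$, arbitrary initial opinions $x_1(0),\dots,x_n(0)\in\mathbf{R}^d$ and given numbers $\alpha_i(t)\in[0,1]$ ($i\in[n]$, $t\in\mathbf{N}$), the opinions evolve by $$x_i(t+1)=\alpha_i(t)\,x_i(t)+\frac{1-\alpha_i(t)}{|N_i(t)|}\sum_{j\in N_i(t)}x_j(t),\qquad N_i(t)=\{j\in[n]:\|x_i(t)-x_j(t)\|\le\epsilon\}$$ (so $i\in N_i(t)$). The profile $\mathscr{G}(t)$ is the undirected graph with vertex set $[n]$ and edge set $\{ij: i\ne j,\ \|x_i(t)-x_j(t)\|\le\epsilon\}$. For $\delta>0$, $\mathscr{G}(t)$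 is $\delta$-trivial if $\|x_i(t)-x_j(t)\|\le\delta$ for all $i,j\in[n]$. *)

(* Defs.v *)
From mathcomp Require Import all_boot all_order all_algebra.
From mathcomp Require Import all_classical all_reals all_analysis.

Set Implicit Arguments.
Unset Strict Implicit.
Unset Printing Implicit Defensive.

Import Order.TTheory GRing.Theory Num.Theory.
Import numFieldNormedType.Exports.

Local Open Scope ring_scope.

(* The library norm `|v| on 'rV[R]_d is the sup norm, hence this definition. *)
Definition l2norm (R : realType) (d : nat) (v : 'rV[R]_d) : R :=
  Num.sqrt (\sum_(k < d) v ord0 k ^+ 2).

Definition neighbors (R : realType) (n d : nat) (eps : R)
    (y : 'I_n -> 'rV[R]_d) (i : 'I_n) : {set 'I_n} :=
  [set j : 'I_n | l2norm (y i - y j) <= eps].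

(* For 0 <= eps, i is one of its own neighbors, so the division by the
   number of neighbors is a genuine one. *)
Definition mixed_HK (R : realType) (n d : nat) (eps : R)
    (alpha : nat -> 'I_n -> R) (x : nat -> 'I_n -> 'rV[R]_d) : Prop :=
  forall (t : nat) (i : 'I_n),
    x t.+1 i = alpha t i *: x t i
      + ((1 - alpha t i) / #|neighbors eps (x t) i|%:R)
          *: \sum_(j in neighbors eps (x t) i) x t j.

Definition trivial_profile (R : realType) (n d : nat) (delta : R)
    (y : 'I_n -> 'rV[R]_d) : Prop :=
  forall i j : 'I_n, l2norm (y i - y j) <= delta.

(* The default value 0 does not affect the two maxima below when 0 < n:
   the index sets contain the pairs (i, i), distances are nonnegative, and
   a - (a - b) / n is nonnegative for 0 <= b <= a. *)
Definition beta (R : realType) (n : nat) (a : 'I_n -> R) : R :=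
  \big[Num.max/0]_(p : 'I_n * 'I_n | a p.1 >= a p.2)
     (a p.1 - (a p.1 - a p.2) / n%:R).

Definition diameter (R : realType) (n d : nat) (y : 'I_n -> 'rV[R]_d) : R :=
  \big[Num.max/0]_(p : 'I_n * 'I_n) l2norm (y p.1 - y p.2).

(* Main.v *)
Require Import Defs.
From mathcomp Require Import all_boot all_order all_algebra.
From mathcomp Require Import all_classical all_reals all_analysis.
From mathcomp Require Import ring.

Set Implicit Arguments.
Unset Strict Implicit.
Unset Printing Implicit Defensive.

Import Order.TTheory GRing.Theory Num.Theory.
Import numFieldNormedType.Exports.

Local Open Scope classical_set_scope.
Local Open Scope ring_scope.

(** Once the profile is [eps]-trivial, every agent hears all the agents, so a
    step moves each opinion towards one common point, the mean [m]:
    [x_i' = a_i x_i + (1 - a_i) m].  For [a_j <= a_i] the mean enters the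
    difference only through [a_i - a_j]:
      [x_i' - x_j' = a_j (x_i - x_j) + (a_i - a_j) (x_i - m)].
    The mean lies within [(1 - 1/n) D] of every opinion, [D] being the diameter,
    because one of the [n] terms it averages is the opinion itself
    ([l2norm_sub_mean]).  The new distance is therefore at most
    [(a_j + (a_i - a_j)(1 - 1/n)) D = (a_i - (a_i - a_j)/n) D], and
    [beta] is the largest of these factors: the diameter is multiplied by at
    most [beta] ([diameter_step]).

    Since [beta <= 1], the diameter does not increase and the profile stays
    [eps]-trivial forever.  Since the limit superior of [beta] is below [1], from
    some time on [beta] is at most a constant [c < 1]
    ([limn_esup_lt1_bound]), and the diameter decays geometrically. *)

(** * The Euclidean norm *)

Lemma l2norm_ge0 (R : realType) (d : nat) (v : 'rV[R]_d) : 0 <= l2norm v.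
Proof. exact: sqrtr_ge0. Qed.

Lemma sqr_l2norm (R : realType) (d : nat) (v : 'rV[R]_d) :
  l2norm v ^+ 2 = \sum_(k < d) v ord0 k ^+ 2.
Proof. by rewrite sqr_sqrtr// sumr_ge0// => k _; rewrite sqr_ge0. Qed.

Lemma l2norm0 (R : realType) (d : nat) : l2norm (0 : 'rV[R]_d) = 0.
Proof.
by rewrite /l2norm big1 ?sqrtr0// => k _; rewrite mxE expr0n.
Qed.

Lemma l2norm0_eq0 (R : realType) (d : nat) (v : 'rV[R]_d) :
  l2norm v = 0 -> v = 0.
Proof.
move=> v0; have /psumr_eq0P vk0 : \sum_(k < d) v ord0 k ^+ 2 = 0.
  by rewrite -sqr_l2norm v0 expr0n.
apply/rowP => k; rewrite mxE; apply/eqP.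
by rewrite -sqrf_eq0 vk0// => l _; rewrite sqr_ge0.
Qed.

Lemma l2normZ (R : realType) (d : nat) (a : R) (v : 'rV[R]_d) :
  l2norm (a *: v) = `|a| * l2norm v.
Proof.
rewrite -sqrtr_sqr -sqrtrM ?sqr_ge0// mulr_sumr; congr Num.sqrt.
by apply: eq_bigr => k _; rewrite mxE exprMn.
Qed.

(** Cauchy-Schwarz: expand the nonnegative sum of the squares
    [(b u_k - a v_k)^2], with [a] and [b] the norms of [u] and [v]. *)
Lemma sum_mul_le_l2norm (R : realType) (d : nat) (u v : 'rV[R]_d) :
  \sum_(k < d) u ord0 k * v ord0 k <= l2norm u * l2norm v.
Proof.
set a := l2norm u; set b := l2norm v; set s := \sum_(k < d) _.
have [/l2norm0_eq0 u0|a_neq0] := eqVneq a 0.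
  by rewrite /s /a u0 l2norm0 mul0r big1// => k _; rewrite mxE mul0r.
have [/l2norm0_eq0 v0|b_neq0] := eqVneq b 0.
  by rewrite /s /b v0 l2norm0 mulr0 big1// => k _; rewrite mxE mulr0.
have ab_gt0 : 0 < a * b by rewrite mulr_gt0// lt0r ?a_neq0 ?b_neq0 l2norm_ge0.
have : 0 <= \sum_(k < d) (b * u ord0 k - a * v ord0 k) ^+ 2.
  by rewrite sumr_ge0// => k _; rewrite sqr_ge0.
have -> : \sum_(k < d) (b * u ord0 k - a * v ord0 k) ^+ 2
          = 2 * (a * b) * (a * b - s).
  transitivity (b ^+ 2 * a ^+ 2 - 2 * (a * b) * s + a ^+ 2 * b ^+ 2);
    last by ring.
  rewrite !sqr_l2norm !mulr_sumr -sumrB -big_split /=.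
  by apply: eq_bigr => k _; rewrite -!sqr_l2norm -/a -/b; ring.
by rewrite pmulr_rge0 ?subr_ge0// mulr_gt0.
Qed.

Lemma ler_l2normD (R : realType) (d : nat) (u v : 'rV[R]_d) :
  l2norm (u + v) <= l2norm u + l2norm v.
Proof.
rewrite -(@ler_pXn2r _ 2%N) ?nnegrE ?addr_ge0 ?l2norm_ge0//.
rewrite sqrrD !sqr_l2norm.
have -> : \sum_(k < d) (u + v) ord0 k ^+ 2 =
    \sum_(k < d) u ord0 k ^+ 2 + (\sum_(k < d) u ord0 k * v ord0 k) *+ 2
    + \sum_(k < d) v ord0 k ^+ 2.
  rewrite -sumrMnl -!big_split /=; apply: eq_bigr => k _.
  by rewrite mxE sqrrD.
by rewrite lerD2r lerD2l lerMn2r sum_mul_le_l2norm.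
Qed.

Lemma ler_l2norm_sum (R : realType) (d : nat) (I : finType) (P : pred I)
    (v : I -> 'rV[R]_d) :
  l2norm (\sum_(i | P i) v i) <= \sum_(i | P i) l2norm (v i).
Proof.
elim/big_ind2 : _ => [|u a w b ua wb|//]; first by rewrite l2norm0.
exact: le_trans (ler_l2normD _ _) (lerD ua wb).
Qed.

(** * Contraction of the diameter in one step *)

Lemma l2norm_sub_le_diameter (R : realType) (n d : nat)
    (y : 'I_n -> 'rV[R]_d) (i j : 'I_n) : l2norm (y i - y j) <= diameter y.
Proof. exact: (le_bigmax _ (fun p => l2norm (y p.1 - y p.2)) (i, j)). Qed.

Lemma diameter_ge0 (R : realType) (n d : nat) (y : 'I_n -> 'rV[R]_d) :
  0 <= diameter y.
Proof. exact: bigmax_ge_id. Qed.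

Lemma trivial_profileE (R : realType) (n d : nat) (delta : R)
    (y : 'I_n -> 'rV[R]_d) (delta_ge0 : 0 <= delta) :
  trivial_profile delta y <-> diameter y <= delta.
Proof.
split=> [y_triv|y_le i j]; first by apply: bigmax_le => // p _; exact: y_triv.
exact: le_trans (l2norm_sub_le_diameter _ _ _) y_le.
Qed.

Definition mean (R : realType) (n d : nat) (y : 'I_n -> 'rV[R]_d) : 'rV[R]_d :=
  n%:R^-1 *: \sum_(j < n) y j.

(** Of the [n] differences [y i - y j] averaged by [y i - mean y], the one with
    [j = i] vanishes; this is where the factor [1 - 1/n] comes from. *)
Lemma l2norm_sub_mean (R : realType) (n d : nat) (y : 'I_n -> 'rV[R]_d)
    (i : 'I_n) : l2norm (y i - mean y) <= (1 - n%:R^-1) * diameter y.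
Proof.
have n_gt0 : 0 < n%:R :> R by rewrite ltr0n (leq_ltn_trans _ (ltn_ord i)).
have n_neq0 : n%:R != 0 :> R by rewrite gt_eqF.
have -> : y i - mean y = n%:R^-1 *: \sum_(j | j != i) (y i - y j).
  have -> : \sum_(j | j != i) (y i - y j) = \sum_j (y i - y j).
    by rewrite [RHS](bigD1 i)//= subrr add0r.
  rewrite sumrB sumr_const card_ord scalerBr -[y i *+ n]scaler_nat scalerA.
  by rewrite mulVf// scale1r.
rewrite l2normZ ger0_norm ?invr_ge0 ?ler0n//.
have -> : 1 - n%:R^-1 = n%:R^-1 * (n.-1)%:R :> R.
  rewrite -subn1 natrB ?mulrBr ?mulVf ?mulr1//.
  by rewrite (leq_ltn_trans _ (ltn_ord i)).
rewrite -mulrA ler_pM2l ?invr_gt0//.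
apply: le_trans (ler_l2norm_sum _ _) _.
have -> : n.-1 = #|predC1 i| by rewrite cardC1 card_ord.
rewrite mulr_natl -sumr_const ler_sum// => j _.
exact: l2norm_sub_le_diameter.
Qed.

Lemma ler_beta (R : realType) (n : nat) (a : 'I_n -> R) (i j : 'I_n) :
  a j <= a i -> a i - (a i - a j) / n%:R <= beta a.
Proof.
exact: (@le_bigmax_cond _ _ _ _ (i, j) (fun p => a p.2 <= a p.1)
          (fun p => a p.1 - (a p.1 - a p.2) / n%:R)).
Qed.

Lemma beta_ge0 (R : realType) (n : nat) (a : 'I_n -> R) : 0 <= beta a.
Proof. exact: bigmax_ge_id. Qed.

Lemma beta_le1 (R : realType) (n : nat) (a : 'I_n -> R) :
  (forall i, a i <= 1) -> beta a <= 1.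
Proof.
move=> a_le1; apply: bigmax_le => // p a_le.
by rewrite lerBlDr ler_wpDr// divr_ge0// subr_ge0.
Qed.

(** The mean cancels from the difference up to a factor [a i - a j], and its
    distance to [y i] is at most [(1 - 1/n)] times the diameter. *)
Lemma l2norm_toward_mean (R : realType) (n d : nat) (a : 'I_n -> R)
    (y : 'I_n -> 'rV[R]_d) (i j : 'I_n) :
    0 <= a j <= a i ->
  l2norm ((a i *: y i + (1 - a i) *: mean y)
          - (a j *: y j + (1 - a j) *: mean y))
  <= beta a * diameter y.
Proof.
move=> /andP[aj_ge0 aj_le].
have -> : (a i *: y i + (1 - a i) *: mean y)
          - (a j *: y j + (1 - a j) *: mean y)
        = a j *: (y i - y j) + (a i - a j) *: (y i - mean y).
  by apply/rowP => k; rewrite !mxE; ring.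
apply: le_trans (ler_l2normD _ _) _.
rewrite !l2normZ (ger0_norm aj_ge0) ger0_norm ?subr_ge0//.
have le_beta := ler_wpM2r (diameter_ge0 y) (ler_beta aj_le).
apply: le_trans _ le_beta.
have -> : (a i - (a i - a j) / n%:R) * diameter y =
    a j * diameter y + (a i - a j) * ((1 - n%:R^-1) * diameter y) by ring.
apply: lerD; first exact/ler_wpM2l/l2norm_sub_le_diameter.
by apply: ler_wpM2l; [rewrite subr_ge0|exact: l2norm_sub_mean].
Qed.

Lemma mixed_HK_trivial_step (R : realType) (n d : nat) (eps : R)
    (alpha : nat -> 'I_n -> R) (x : nat -> 'I_n -> 'rV[R]_d) (t : nat)
    (i : 'I_n) :
    mixed_HK eps alpha x -> trivial_profile eps (x t) ->
  x t.+1 i = alpha t i *: x t i + (1 - alpha t i) *: mean (x t).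
Proof.
move=> x_traj x_triv; rewrite x_traj.
have -> : neighbors eps (x t) i = [set: 'I_n]%SET.
  by apply/setP => j; rewrite !inE x_triv.
rewrite cardsT card_ord /mean scalerA; congr (_ + _ *: _).
by apply: eq_bigl => j; rewrite inE.
Qed.

Lemma diameter_step (R : realType) (n d : nat) (eps : R)
    (alpha : nat -> 'I_n -> R) (x : nat -> 'I_n -> 'rV[R]_d) (t : nat) :
    mixed_HK eps alpha x -> (forall i, 0 <= alpha t i) ->
    trivial_profile eps (x t) ->
  diameter (x t.+1) <= beta (alpha t) * diameter (x t).
Proof.
move=> x_traj alpha_ge0 x_triv.
apply: bigmax_le => [|[i j] _ /=].
  by rewrite mulr_ge0 ?beta_ge0 ?diameter_ge0.
rewrite !(mixed_HK_trivial_step _ x_traj x_triv).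
have [aji|/ltW aij] := leP (alpha t j) (alpha t i).
  by apply: l2norm_toward_mean; rewrite alpha_ge0.
rewrite -opprB -scaleN1r l2normZ normrN1 mul1r.
by apply: l2norm_toward_mean; rewrite alpha_ge0.
Qed.

(** * Geometric decay *)

(** The limit superior is the infimum of the suprema of the tails, so some tail
    has supremum below [1]; that supremum also dominates a nonnegative term, hence
    it is a real number and can serve as [c]. *)
Lemma limn_esup_lt1_bound (R : realType) (u : nat -> R) :
    (forall t, 0 <= u t) ->
    (limn_esup (fun t : nat => (u t)%:E) < 1%:E)%E ->
  exists c N, 0 <= c < 1 /\ forall t, (N <= t)%N -> u t <= c.
Proof.
move=> u_ge0 /ereal_inf_lt[_ [V [N _ NV] <-]].
set s := ereal_sup _ => s_lt1.
have u_le_s t : (N <= t)%N -> ((u t)%:E <= s)%E.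
  by move=> Nt; apply: ereal_sup_ubound; exists t => //; exact: NV.
have s_ge0 : (0 <= s)%E.
  by apply: le_trans (u_le_s N (leqnn N)); rewrite lee_fin u_ge0.
have s_fin : s \is a fin_num.
  by rewrite ge0_fin_numE// (lt_trans s_lt1)// ltry.
exists (fine s), N; split=> [|t Nt].
  by rewrite fine_ge0//= -lte_fin fineK.
by rewrite -lee_fin fineK// u_le_s.
Qed.

Lemma cvg0_contraction (R : realType) (u : nat -> R) (c : R) (N : nat) :
    (forall t, 0 <= u t) -> 0 <= c < 1 ->
    (forall t, (N <= t)%N -> u t.+1 <= c * u t) ->
  u @ \oo --> (0 : R).
Proof.
move=> u_ge0 /andP[c_ge0 c_lt1] u_step.
rewrite -(cvg_shiftn N).
apply: (@squeeze_cvgr _ _ _ _ (fun=> 0) (geometric (u N) c)).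
- apply: nearW => t /=; rewrite u_ge0 /=.
  elim: t => [|t IHt]; first by rewrite expr0 mulr1.
  rewrite addSn exprS mulrCA (le_trans (u_step _ (leq_addl _ _)))//.
  exact: ler_wpM2l.
- exact: cvg_cst.
- by apply: cvg_geometric; rewrite ger0_norm.
Qed.

Theorem theorem1 (R : realType) (n d : nat) (eps : R)
    (alpha : nat -> 'I_n -> R) (x : nat -> 'I_n -> 'rV[R]_d)
    (n_gt0 : (0 < n)%N) (eps_gt0 : 0 < eps)
    (alpha01 : forall (t : nat) (i : 'I_n), 0 <= alpha t i <= 1)
    (x_traj : mixed_HK eps alpha x)
    (limsup_beta : (limn_esup (fun t : nat => (beta (alpha t))%:E) < 1%:E)%E)
    (triv : exists t0 : nat, trivial_profile eps (x t0)) :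
  (fun t : nat => diameter (x t)) @ \oo --> (0 : R).
Proof.
case: triv => t0 triv0.
have alpha_ge0 t i : 0 <= alpha t i by case/andP: (alpha01 t i).
have alpha_le1 t i : alpha t i <= 1 by case/andP: (alpha01 t i).
have diameter_decr t : trivial_profile eps (x t) ->
    diameter (x t.+1) <= beta (alpha t) * diameter (x t).
  by move=> ?; apply: diameter_step x_traj _ _.
have trivP t := trivial_profileE (x t) (ltW eps_gt0).
have triv_after t : (t0 <= t)%N -> trivial_profile eps (x t).
  elim: t => [|t IHt]; first by rewrite leqn0 => /eqP <-.
  rewrite leq_eqVlt => /predU1P[<-//|/IHt x_triv].
  apply/trivP; apply: le_trans (diameter_decr _ x_triv) _.
  have /trivP := x_triv; apply: le_trans.
  by rewrite ler_piMl ?diameter_ge0 ?beta_le1.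
have [c [N [c01 beta_le_c]]] :=
  limn_esup_lt1_bound (fun t => beta_ge0 (alpha t)) limsup_beta.
apply: (@cvg0_contraction _ _ c (maxn t0 N) _ c01) => [t|t].
  exact: diameter_ge0.
rewrite geq_max => /andP[t0_le N_le].
apply: le_trans (diameter_decr _ (triv_after _ t0_le)) _.
by apply: ler_wpM2r; [exact: diameter_ge0|exact: beta_le_c].
Qed.
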